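(* Let $G$ be a topological group. Any homogeneous distributive binary $G$-space is transitive.
   Context: A binary action of a topological group $G$ on a topological space $X$ is a continuous map $\mu : G\times X\times X\to X$, written $\mu(g,x,y)=g(x,y)$, such that $gh(x,y)=g(x,h(x,y))$ and $e(x,y)=y$ for all $g,h\in G$, $x,y\in X$, where $e$ is the identity of $G$. The triple $(G,X,\mu)$ (or just $X$) is then called a binary $G$-space. A binary $G$-space $X$ is distributive if $g(h(x,x'),h(x,x''))=h(x,g(x',x''))$ for all $x,x',x''\in X$ and $g,h\in G$. For $A\subset X$ put $G(A,A)=\{g(a_1,a_2): g\in G,\ a_1,a_2\in A\}$, and for $x\in X$ put $G(x,x)=\{g(x,x): g\in G\}$. A subset $A\subset X$ is bi-invariant if $G(A,A)=A$. The orbit $[x]$ of $x\in X$ is the minimal bi-invariant subset of $X$ containing $x$. A binary $G$-space $X$ is homogeneous if there is a point $x\in X$ with $[x]=X$. It is transitive if $G(x,x)=X$ for every $x\in X$, i.e. there is precisely one orbit, $X$ itself. *)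

(* Defs.v *)
From HB Require Import structures.
From mathcomp Require Import all_boot.
From mathcomp Require Import boolp classical_sets topology.

Set Implicit Arguments.
Unset Strict Implicit.
Unset Printing Implicit Defensive.

Local Open Scope classical_set_scope.

HB.mixin Record isTopologicalGroup G of Topological G & Group G := {
  mulg_continuous : continuous (fun p : G * G => (p.1 * p.2)%g);
  invg_continuous : continuous (fun g : G => g^-1%g)
}.

#[short(type="topologicalGroupType")]
HB.structure Definition TopologicalGroup :=
  {G of isTopologicalGroup G & Topological G & Group G}.

Record binary_action (G : topologicalGroupType) (X : topologicalType) := {
  bact :> G -> X -> X -> X;
  bact_continuous : continuous (fun p : G * X * X => bact p.1.1 p.1.2 p.2);
  bactM : forall (g h : G) (x y : X), bact (g * h)%g x y = bact g x (bact h x y);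
  bact1 : forall x y : X, bact 1%g x y = y
}.

Section BinaryGSpace.
Context {G : topologicalGroupType} {X : topologicalType}.
Variable mu : binary_action G X.

Definition bdistributive : Prop :=
  forall (g h : G) (x x' x'' : X),
    mu g (mu h x x') (mu h x x'') = mu h x (mu g x' x'').

Definition bact_set (A : set X) : set X :=
  [set y | exists (g : G) (a1 a2 : X), [/\ A a1, A a2 & y = mu g a1 a2]].

Definition bact_diag (x : X) : set X := range (fun g : G => mu g x x).

Definition bi_invariant (A : set X) : Prop := bact_set A = A.

(* [smallest] is an intersection, so it is a minimal bi-invariant set only
   because bi-invariance is stable under intersections: see [borbit_min]. *)
Definition borbit (x : X) : set X := smallest bi_invariant [set x].

Lemma bi_invariantP (A : set X) :
  bi_invariant A <-> (forall g a1 a2, A a1 -> A a2 -> A (mu g a1 a2)).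
Proof.
split=> [AA g a1 a2 Aa1 Aa2|AA]; first by rewrite -AA; exists g, a1, a2.
apply/seteqP; split=> [_ [g [a1 [a2 [Aa1 Aa2 ->]]]]|a Aa]; first exact: AA.
by exists 1%g, a, a; rewrite bact1.
Qed.

Lemma borbit_min (x : X) :
  [/\ bi_invariant (borbit x), borbit x x &
      forall A, bi_invariant A -> A x -> borbit x `<=` A].
Proof.
split.
- apply/bi_invariantP => g a1 a2 a1x a2x A [/[dup] /bi_invariantP AA iA xA].
  by apply: AA; [apply: a1x|apply: a2x].
- exact: sub_gen_smallest.
- by move=> A iA Ax; apply: smallest_sub => // _ ->.
Qed.

Definition bhomogeneous : Prop := exists x : X, borbit x = setT.

Definition btransitive : Prop := forall x : X, bact_diag x = setT.

End BinaryGSpace.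

(* Main.v *)
Require Import Defs.
From mathcomp Require Import all_boot.
From mathcomp Require Import classical_sets topology.

(** For a fixed point [x], the maps [mu g x] form an ordinary action of [G], and
    the diagonal set [bact_diag mu x] is the orbit of [x] under it.
    Distributivity lets a common first factor [h(x, _)] be pulled out of
    [g(_, _)].  Since the action at [x] is invertible, any [k(x, x)] can be
    written [h(x, (h^-1 k)(x, x))]; so two points of the diagonal set always have
    such a common factor, and the diagonal set is bi-invariant.  It therefore
    contains the orbit [[x]], and homogeneity forces it to be all of [X] for one
    [x].  Pulling out the factor once more, at [y = h(x, x)], gives
    [g(y, y) = (h g)(x, x)]; as [h g] runs over [G], the points [x] and [y] have
    the same diagonal set. *)

Local Open Scope classical_set_scope.

(** Two points [h(x, x)] and [k(x, x)] share the factor [h(x, _)], so [g] maps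
    them to [h(x, g(x, (h^-1 k)(x, x))) = (h g h^-1 k)(x, x)]. *)
Lemma bdistributive_diag_bi_invariant (G : topologicalGroupType)
    (X : topologicalType) (mu : binary_action G X) (x : X) :
  bdistributive mu -> bi_invariant mu (bact_diag mu x).
Proof.
move=> distr; apply/bi_invariantP => g _ _ [h _ <-] [k _ <-].
exists (h * (g * (h^-1 * k)))%g => //.
(* exhibit [h(x, _)] as a common factor of both arguments of [g] *)
have -> : mu k x x = mu h x (mu (h^-1 * k)%g x x) by rewrite -bactM mulVKg.
by rewrite distr !bactM.
Qed.

Lemma borbit_sub_diag (G : topologicalGroupType) (X : topologicalType)
    (mu : binary_action G X) (x : X) :
  bdistributive mu -> borbit mu x `<=` bact_diag mu x.
Proof.
move=> distr; have [_ _] := borbit_min mu x; apply.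
  exact: bdistributive_diag_bi_invariant.
by exists 1%g => //; rewrite bact1.
Qed.

Lemma bdistributive_bact_diag (G : topologicalGroupType) (X : topologicalType)
    (mu : binary_action G X) (g h : G) (x : X) :
  bdistributive mu -> mu g (mu h x x) (mu h x x) = mu (h * g)%g x x.
Proof. by move=> distr; rewrite distr bactM. Qed.

Theorem proposition3 (G : topologicalGroupType) (X : topologicalType)
    (mu : binary_action G X) :
  bhomogeneous mu -> bdistributive mu -> btransitive mu.
Proof.
move=> [x orbx] distr.
have diagx z : bact_diag mu x z by apply: borbit_sub_diag; rewrite // orbx.
move=> y; apply/seteqP; split=> // z _.
have [h _ <-] := diagx y; have [k _ <-] := diagx z.
by exists (h^-1 * k)%g => //; rewrite bdistributive_bact_diag // mulVKg.
Qed.
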